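(* Let $(\mathfrak{g},[\cdot,\cdot]_\mathfrak{g},N)$ be a Nijenhuis Lie algebra and $(\mathfrak{g},\delta,S)$ a Nijenhuis Lie coalgebra, both defined on the same finite-dimensional vector space $\mathfrak{g}$. Let $(\mathfrak{g}^*,[\cdot,\cdot]_{\mathfrak{g}^*},S^* )$ be the Nijenhuis Lie algebra dual to $(\mathfrak{g},\delta,S)$. Then the following are equivalent: (i) $(\mathfrak{g},[\cdot,\cdot]_\mathfrak{g},N,\delta,S)$ is a Nijenhuis Lie bialgebra; (ii) $\big((\mathfrak{g},[\cdot,\cdot]_\mathfrak{g},N),(\mathfrak{g}^*,[\cdot,\cdot]_{\mathfrak{g}^*},S^* ),\mathrm{ad}^*_\mathfrak{g},\mathrm{ad}^*_{\mathfrak{g}^*}\big)$ is a matched pair of Nijenhuis Lie algebras; (iii) $\big((\mathfrak{g}\oplus\mathfrak{g}^*,[\cdot,\cdot]_{\Join},N\oplus S^* ),(\mathfrak{g},[\cdot,\cdot]_\mathfrak{g},N),(\mathfrak{g}^*,[\cdot,\cdot]_{\mathfrak{g}^*},S^* )\big)$ is a Manin triple of Nijenhuis Lie algebras.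
   Context: A Nijenhuis operator on a Lie algebra $(\mathfrak{g},[\cdot,\cdot]_\mathfrak{g})$ is a linear map $N$ with $[Nx,Ny]_\mathfrak{g}=N([Nx,y]_\mathfrak{g}+[x,Ny]_\mathfrak{g}-N[x,y]_\mathfrak{g})$; the triple $(\mathfrak{g},[\cdot,\cdot]_\mathfrak{g},N)$ is a Nijenhuis Lie algebra. A Nijenhuis representation of it is $(\mathcal{V},\rho,S)$ with $(\mathcal{V},\rho)$ a Lie algebra representation and $S:\mathcal{V}\to\mathcal{V}$ linear with $\rho_{Nx}S(v)=S(\rho_{Nx}v+\rho_xS(v)-S(\rho_xv))$. A Lie coalgebra $(\mathfrak{g},\delta)$: $\delta:\mathfrak{g}\to\mathfrak{g}\otimes\mathfrak{g}$ linear with $\delta=-\tau\delta$ ($\tau$ the flip) and $(\mathrm{Id}+\sigma+\sigma^2)(\mathrm{Id}\otimes\delta)\delta=0$, $\sigma(x\otimes y\otimes z)=y\otimes z\otimes x$. A Nijenhuis Lie coalgebra $(\mathfrak{g},\delta,S)$ is a Lie coalgebra with linear $S:\mathfrak{g}\to\mathfrak{g}$ satisfying $(S\otimes S)\delta(x)=(S\otimes\mathrm{Id}+\mathrm{Id}\otimes S)\delta(S(x))-\delta(S^2(x))$. Its dual Nijenhuis Lie algebra is $(\mathfrak{g}^*,[\cdot,\cdot]_{\mathfrak{g}^*},S^* )$ with $\langle[\alpha,\beta]_{\mathfrak{g}^*},x\rangle=\langle\delta(x),\alpha\otimes\beta\rangle$ and $S^*$ the transpose of $S$. A Nijenhuis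 Lie bialgebra $(\mathfrak{g},[\cdot,\cdot]_\mathfrak{g},N,\delta,S)$ consists of a Nijenhuis Lie algebra $(\mathfrak{g},[\cdot,\cdot]_\mathfrak{g},N)$ and a Nijenhuis Lie coalgebra $(\mathfrak{g},\delta,S)$ such that, for all $x,y\in\mathfrak{g}$: (a) $\delta([x,y]_\mathfrak{g})=(\mathrm{ad}_x\otimes\mathrm{Id}+\mathrm{Id}\otimes\mathrm{ad}_x)\delta(y)-(\mathrm{ad}_y\otimes\mathrm{Id}+\mathrm{Id}\otimes\mathrm{ad}_y)\delta(x)$ (i.e. $(\mathfrak{g},[\cdot,\cdot]_\mathfrak{g},\delta)$ is a Lie bialgebra); (b) $S[Nx,y]_\mathfrak{g}+[x,S^2y]_\mathfrak{g}=[Nx,Sy]_\mathfrak{g}+S[x,Sy]_\mathfrak{g}$; (c) $(N\otimes S)\delta(x)+(N\otimes\mathrm{Id}-\mathrm{Id}\otimes S)\delta(N(x))-(N^2\otimes\mathrm{Id})\delta(x)=0$. A matched pair of Lie algebras $(\mathfrak{g},\mathfrak{h},\rho,\nu)$: Lie algebras $\mathfrak{g},\mathfrak{h}$ with representations $\rho:\mathfrak{g}\to\mathrm{End}(\mathfrak{h})$, $\nu:\mathfrak{h}\to\mathrm{End}(\mathfrak{g})$ such that $\rho_x[h,k]_\mathfrak{h}=[\rho_xh,k]_\mathfrak{h}+[h,\rho_xk]_\mathfrak{h}+\rho_{\nu_kx}h-\rho_{\nu_hx}k$ and $\nu_h[x,y]_\mathfrak{g}=[\nu_hx,y]_\mathfrak{g}+[x,\nu_hy]_\mathfrak{g}+\nu_{\rho_yh}x-\nu_{\rho_xh}y$.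 A matched pair of Nijenhuis Lie algebras $((\mathfrak{g},[\cdot,\cdot]_\mathfrak{g},N),(\mathfrak{h},[\cdot,\cdot]_\mathfrak{h},S),\rho,\nu)$ is a matched pair of the underlying Lie algebras such that $(\mathfrak{h},\rho,S)$ is a Nijenhuis representation of $(\mathfrak{g},[\cdot,\cdot]_\mathfrak{g},N)$ and $(\mathfrak{g},\nu,N)$ is a Nijenhuis representation of $(\mathfrak{h},[\cdot,\cdot]_\mathfrak{h},S)$. The bicrossed product bracket on $\mathfrak{g}\oplus\mathfrak{h}$ is $[(x,h),(y,k)]_{\Join}=([x,y]_\mathfrak{g}+\nu_hy-\nu_kx,\ [h,k]_\mathfrak{h}+\rho_xk-\rho_yh)$. In (iii), $[\cdot,\cdot]_{\Join}$ is given by this formula with $\mathfrak{h}=\mathfrak{g}^*$, $\rho=\mathrm{ad}^*_\mathfrak{g}$, $\nu=\mathrm{ad}^*_{\mathfrak{g}^*}$, where $\langle(\mathrm{ad}^*_\mathfrak{g})_x\alpha,y\rangle=-\langle\alpha,[x,y]_\mathfrak{g}\rangle$ and $\langle\beta,(\mathrm{ad}^*_{\mathfrak{g}^*})_\alpha x\rangle=-\langle[\alpha,\beta]_{\mathfrak{g}^*},x\rangle$ (using $\mathfrak{g}^{**}=\mathfrak{g}$). A Manin triple of Nijenhuis Lie algebras is $((\mathfrak{g}\oplus\mathfrak{g}^*,[\cdot,\cdot],\mathcal{N}),(\mathfrak{g},[\cdot,\cdot]_\mathfrak{g},N),(\mathfrak{g}^*,[\cdot,\cdot]_{\mathfrak{g}^*},S^*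 ))$ where the first is a Nijenhuis Lie algebra having the other two as Nijenhuis Lie subalgebras, and the symmetric bilinear form $\mathcal{B}(x+\alpha,y+\beta)=\alpha(y)+\beta(x)$ on $\mathfrak{g}\oplus\mathfrak{g}^*$ is ad-invariant for $[\cdot,\cdot]$. *)

(* Defs.v *)
From HB Require Import structures.
From mathcomp Require Import all_boot all_algebra.

Set Implicit Arguments.
Unset Strict Implicit.
Unset Printing Implicit Defensive.

Import GRing.Theory.
Local Open Scope ring_scope.

(* The library's [bilinear_for] is a product in [Type]; this is its [Prop]
   counterpart for two-argument maps over one field. *)
Definition bilinear (F : fieldType) (U V W : vectType F) (f : U -> V -> W) :
    Prop :=
  (forall v, linear (f^~ v)) /\ (forall u, linear (f u)).

Lemma linfun_linE (F : fieldType) (V W : vectType F) (f : V -> W) (x : V) :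
  linear f -> linfun f x = f x.
Proof.
move=> lin; pose h := GRing.isLinear.Build F V W *:%R f lin.
by pose g : {linear V -> W} := HB.pack f h; exact: (lfunE g).
Qed.

(* An element of V (x) W is stored as its matrix of coordinates on the vectors
   e_i (x) e'_j, for the library's bases vbasis {:V} and vbasis {:W}.  All maps
   on tensors are defined through the universal property ([tens_bilinear],
   [tliftE], [tlift_uniq]), so nothing below depends on the choice of bases. *)
Notation tensor V W := 'M[_]_(\dim {:V}, \dim {:W}).

Definition tens (F : fieldType) (V W : vectType F) (v : V) (w : W) :
    tensor V W :=
  \matrix_(i, j) (coord (vbasis {:V}) i v * coord (vbasis {:W}) j w).

Definition tlift_fun (F : fieldType) (V W U : vectType F) (f : V -> W -> U)
    (t : tensor V W) : U :=
  \sum_i \sum_j t i j *: f (vbasis {:V})`_i (vbasis {:W})`_j.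

Lemma tlift_fun_linear (F : fieldType) (V W U : vectType F)
    (f : V -> W -> U) : linear (tlift_fun f).
Proof.
move=> a s t; rewrite /tlift_fun scaler_sumr -big_split /=.
apply: eq_bigr => i _; rewrite scaler_sumr -big_split /=.
by apply: eq_bigr => j _; rewrite !mxE scalerDl scalerA.
Qed.

HB.instance Definition _ (F : fieldType) (V W U : vectType F)
    (f : V -> W -> U) :=
  GRing.isLinear.Build F (tensor V W) U *:%R (tlift_fun f)
    (tlift_fun_linear f).

(* The linear map on V (x) W induced by a bilinear map f on V * W. *)
Definition tlift (F : fieldType) (V W U : vectType F) (f : V -> W -> U) :
    'Hom(tensor V W, U) :=
  linfun (tlift_fun f).

Section TensorUniversalProperty.
Variables (F : fieldType) (V W : vectType F).

Lemma tens_bilinear : bilinear (@tens F V W).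
Proof.
split=> [w a v v' | v a w w']; apply/matrixP => i j; rewrite !mxE linearP /=.
  by rewrite mulrDl mulrA.
by rewrite mulrDr mulrCA.
Qed.

Lemma tens_vbasis (i : 'I_(\dim {:V})) (j : 'I_(\dim {:W})) :
  tens (vbasis {:V})`_i (vbasis {:W})`_j = delta_mx i j.
Proof.
apply/matrixP => k l; rewrite !mxE !coord_free ?(basis_free (vbasisP _)) //.
by rewrite [i == k]eq_sym [j == l]eq_sym -natrM mulnb.
Qed.

Variable U : vectType F.

Lemma tliftE (f : V -> W -> U) (v : V) (w : W) :
  bilinear f -> tlift f (tens v w) = f v w.
Proof.
move=> [fl fr]; rewrite lfunE /= /tlift_fun.
pose hl := GRing.isLinear.Build F V U *:%R (f^~ w) (fl w).
pose gl : {linear V -> U} := HB.pack (f^~ w) hl.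
transitivity (gl v) => //.
rewrite {2}(coord_vbasis (memvf v)) linear_sum; apply: eq_bigr => i _.
rewrite linearZ /=.
pose hr := GRing.isLinear.Build F W U *:%R (f (vbasis {:V})`_i) (fr _).
pose gr : {linear W -> U} := HB.pack (f (vbasis {:V})`_i) hr.
rewrite -[f _ w]/(gr w) {2}(coord_vbasis (memvf w)) linear_sum scaler_sumr.
by apply: eq_bigr => j _; rewrite linearZ /= scalerA mxE.
Qed.

Lemma tlift_uniq (h h' : 'Hom(tensor V W, U)) :
  (forall v w, h (tens v w) = h' (tens v w)) -> h = h'.
Proof.
move=> eqh; apply/lfunP => t; rewrite [t]matrix_sum_delta !linear_sum /=.
apply: eq_bigr => i _; rewrite !linear_sum /=; apply: eq_bigr => j _.
by rewrite !linearZ /= -tens_vbasis eqh.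
Qed.

End TensorUniversalProperty.

Definition tmap (F : fieldType) (V W V' W' : vectType F)
    (f : 'Hom(V, V')) (g : 'Hom(W, W')) : 'Hom(tensor V W, tensor V' W') :=
  tlift (fun v w => tens (f v) (g w)).

Definition tflip (F : fieldType) (V : vectType F) : 'End(tensor V V) :=
  tlift (fun x y => tens y x).

(* sigma (x (x) y (x) z) = y (x) z (x) x, on V (x) (V (x) V). *)
Definition trot (F : fieldType) (V : vectType F) :
    'End(tensor V (tensor V V)) :=
  tlift (fun x => tlift (fun y z => tens y (tens z x))).

Lemma tmapE (F : fieldType) (V W V' W' : vectType F)
    (f : 'Hom(V, V')) (g : 'Hom(W, W')) (v : V) (w : W) :
  tmap f g (tens v w) = tens (f v) (g w).
Proof.
have [tl tr] := @tens_bilinear F V' W'.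
apply: tliftE; split=> [y | x] c u u'; rewrite /= linearP; first exact: (tl _ c).
exact: (tr _ c).
Qed.

Lemma tflipE (F : fieldType) (V : vectType F) (x y : V) :
  tflip V (tens x y) = tens y x.
Proof.
have [tl tr] := @tens_bilinear F V V.
by apply: tliftE; split=> [z | z] c u u' /=; [exact: (tr _ c) | exact: (tl _ c)].
Qed.

Lemma trotE (F : fieldType) (V : vectType F) (x y z : V) :
  trot V (tens x (tens y z)) = tens y (tens z x).
Proof.
have [tl tr] := @tens_bilinear F V V.
have [tl3 tr3] := @tens_bilinear F V (tensor V V).
have inner u : bilinear (fun y z : V => tens y (tens z u) : tensor V (tensor V V)).
  split=> [w | w] c v v' /=; first exact: (tl3 _ c v v').
  by rewrite -(tr3 w c); congr (tens w _); exact: (tl u c).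
pose h w := tlift (fun y z : V => tens y (tens z w) : tensor V (tensor V V)).
have hE v a b : h v (tens a b) = tens a (tens b v) by exact: tliftE.
have h_lin : linear h.
  move=> c v v'; apply: tlift_uniq => a b.
  rewrite add_lfunE scale_lfunE !hE.
  by rewrite -(tr3 a c); congr (tens a _); exact: (tr b c).
rewrite -[RHS]hE; refine (tliftE (f := fun w t => h w t) x (tens y z) _).
split=> [t | u] c v v' /=; last exact: linearP.
by rewrite h_lin add_lfunE scale_lfunE.
Qed.

Notation dual V := 'Hom(V, _^o).

Lemma transpose_linear (F : fieldType) (V : vectType F) (f : 'End(V)) :
  linear (fun a : dual V => (a \o f)%VF).
Proof. by move=> c a b; rewrite comp_lfunDl comp_lfunZl. Qed.

Definition transpose (F : fieldType) (V : vectType F) (f : 'End(V)) :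
    'End(dual V) :=
  linfun (fun a : dual V => (a \o f)%VF).

Lemma transposeE (F : fieldType) (V : vectType F) (f : 'End(V)) (a : dual V) :
  transpose f a = (a \o f)%VF.
Proof. exact: linfun_linE (transpose_linear f). Qed.

(* The pairing <t, a (x) b>, for t in V (x) V. *)
Definition tpair (F : fieldType) (V : vectType F) (a b : dual V) :
    dual (tensor V V) :=
  tlift (fun x y => (a x * b y : F^o)).

Lemma tpairE (F : fieldType) (V : vectType F) (a b : dual V) (x y : V) :
  tpair a b (tens x y) = a x * b y.
Proof.
rewrite /tpair tliftE //; split=> [z | z] c u u'; rewrite linearP /=.
  by rewrite mulrDl -scalerAl.
by rewrite mulrDr -scalerAr.
Qed.

Lemma eval_linear (F : fieldType) (V : vectType F) (x : V) :
  linear (fun a : dual V => a x : F^o).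
Proof. by move=> c a b; rewrite add_lfunE scale_lfunE. Qed.

Definition eval_at (F : fieldType) (V : vectType F) (x : V) : dual (dual V) :=
  linfun (fun a : dual V => a x : F^o).

Lemma eval_atE (F : fieldType) (V : vectType F) (x : V) (a : dual V) :
  eval_at x a = a x.
Proof. exact: linfun_linE (eval_linear x). Qed.

Lemma eval_at_linear (F : fieldType) (V : vectType F) :
  linear (@eval_at F V).
Proof.
by move=> c x y; apply/lfunP => a; rewrite add_lfunE scale_lfunE !eval_atE linearP.
Qed.

(* The canonical map from V to its bidual, x |-> (a |-> a x). *)
Definition bidual (F : fieldType) (V : vectType F) : 'Hom(V, dual (dual V)) :=
  linfun (@eval_at F V).

Lemma bidualE (F : fieldType) (V : vectType F) (x : V) (a : dual V) :
  bidual V x a = a x.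
Proof. by rewrite /bidual (linfun_linE _ (@eval_at_linear F V)) eval_atE. Qed.

Lemma bidual_inj (F : fieldType) (V : vectType F) : lker (bidual V) == 0%VS.
Proof.
apply/lker0P => x y eq_xy; have eval (a : dual V) : a x = a y.
  by rewrite -(bidualE x) -(bidualE y) eq_xy.
rewrite (coord_vbasis (memvf x)) (coord_vbasis (memvf y)).
apply: eq_bigr => i _; congr (_ *: _).
have lin : linear (coord (vbasis {:V}) i : V -> F^o) by exact: linearP.
have := eval (linfun (coord (vbasis {:V}) i : V -> F^o)).
by rewrite !(linfun_linE _ lin).
Qed.

Lemma bidualK (F : fieldType) (V : vectType F) (u : dual (dual V)) :
  bidual V ((bidual V)^-1%VF u) = u.
Proof.
apply: limg_lfunVK; suff -> : limg (bidual V) = fullv by rewrite memvf.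
apply/eqP; rewrite eqEdim subvf /= limg_dim_eq; last first.
  by rewrite (eqP (bidual_inj V)) capv0.
have dim_dual (W : vectType F) : \dim {: dual W} = \dim {:W}.
  by rewrite !dimvf; exact: muln1.
by rewrite !dim_dual.
Qed.

(* Skew-symmetry is [x, y] = - [y, x], the condition dual to delta = - tau delta;
   it agrees with [x, x] = 0 unless the characteristic is 2. *)
Definition lie_algebra (F : fieldType) (V : vectType F) (br : V -> V -> V) :
    Prop :=
  [/\ bilinear br,
      forall x y, br x y = - br y x
    & forall x y z, br x (br y z) + br y (br z x) + br z (br x y) = 0].

Definition nijenhuis_lie_algebra (F : fieldType) (V : vectType F)
    (br : V -> V -> V) (N : 'End(V)) : Prop :=
  lie_algebra br /\
  forall x y, br (N x) (N y) = N (br (N x) y + br x (N y) - N (br x y)).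

Definition lie_representation (F : fieldType) (V W : vectType F)
    (br : V -> V -> V) (rho : V -> W -> W) : Prop :=
  bilinear rho /\
  forall x y w, rho (br x y) w = rho x (rho y w) - rho y (rho x w).

Definition nijenhuis_representation (F : fieldType) (V W : vectType F)
    (br : V -> V -> V) (N : 'End(V)) (rho : V -> W -> W) (S : 'End(W)) :
    Prop :=
  lie_representation br rho /\
  forall x w,
    rho (N x) (S w) = S (rho (N x) w + rho x (S w) - S (rho x w)).

Definition lie_coalgebra (F : fieldType) (V : vectType F)
    (delta : 'Hom(V, tensor V V)) : Prop :=
  delta = - (tflip V \o delta)%VF /\
  ((\1 + trot V + (trot V \o trot V)) \o (tmap \1 delta \o delta) = 0)%VF.

Definition nijenhuis_lie_coalgebra (F : fieldType) (V : vectType F)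
    (delta : 'Hom(V, tensor V V)) (S : 'End(V)) : Prop :=
  lie_coalgebra delta /\
  forall x,
    tmap S S (delta x) =
      (tmap S \1 + tmap \1 S)%VF (delta (S x)) - delta (S (S x)).

(* [linfun] returns its argument only when that argument is linear, so [ad] and
   [coad] are meaningful for bilinear br (see [linfun_linE]). *)
Definition ad (F : fieldType) (V : vectType F) (br : V -> V -> V) (x : V) :
    'End(V) :=
  linfun (br x).

Definition lie_bialgebra (F : fieldType) (V : vectType F)
    (br : V -> V -> V) (delta : 'Hom(V, tensor V V)) : Prop :=
  [/\ lie_algebra br,
      lie_coalgebra delta
    & forall x y,
        delta (br x y) =
          (tmap (ad br x) \1 + tmap \1 (ad br x))%VF (delta y)
          - (tmap (ad br y) \1 + tmap \1 (ad br y))%VF (delta x)].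

Definition nijenhuis_lie_bialgebra (F : fieldType) (V : vectType F)
    (br : V -> V -> V) (N : 'End(V)) (delta : 'Hom(V, tensor V V))
    (S : 'End(V)) : Prop :=
  [/\ nijenhuis_lie_algebra br N,
      nijenhuis_lie_coalgebra delta S,
      lie_bialgebra br delta,
      forall x y,
        S (br (N x) y) + br x (S (S y)) = br (N x) (S y) + S (br x (S y))
    & forall x,
        tmap N S (delta x) + (tmap N \1 - tmap \1 S)%VF (delta (N x))
          - tmap (N \o N)%VF \1%VF (delta x) = 0].

Definition matched_pair (F : fieldType) (V W : vectType F)
    (brV : V -> V -> V) (brW : W -> W -> W)
    (rho : V -> W -> W) (nu : W -> V -> V) : Prop :=
  [/\ lie_algebra brV /\ lie_algebra brW,
      lie_representation brV rho,
      lie_representation brW nu,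
      forall x h k,
        rho x (brW h k) =
          brW (rho x h) k + brW h (rho x k) + rho (nu k x) h - rho (nu h x) k
    & forall h x y,
        nu h (brV x y) =
          brV (nu h x) y + brV x (nu h y) + nu (rho y h) x - nu (rho x h) y].

Definition nijenhuis_matched_pair (F : fieldType) (V W : vectType F)
    (brV : V -> V -> V) (N : 'End(V)) (brW : W -> W -> W) (S : 'End(W))
    (rho : V -> W -> W) (nu : W -> V -> V) : Prop :=
  [/\ nijenhuis_lie_algebra brV N,
      nijenhuis_lie_algebra brW S,
      matched_pair brV brW rho nu,
      nijenhuis_representation brV N rho S
    & nijenhuis_representation brW S nu N].

Definition bicrossed (F : fieldType) (V W : vectType F)
    (brV : V -> V -> V) (brW : W -> W -> W)
    (rho : V -> W -> W) (nu : W -> V -> V) (u v : V * W) : V * W :=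
  (brV u.1 v.1 + nu u.2 v.1 - nu v.2 u.1,
   brW u.2 v.2 + rho u.1 v.2 - rho v.1 u.2).

Definition dual_bracket (F : fieldType) (V : vectType F)
    (delta : 'Hom(V, tensor V V)) (a b : dual V) : dual V :=
  (tpair a b \o delta)%VF.

(* <ad*_x a, y> = - <a, [x, y]>. *)
Definition coad (F : fieldType) (V : vectType F) (br : V -> V -> V)
    (x : V) (a : dual V) : dual V :=
  - (a \o ad br x)%VF.

(* The coadjoint action of a Lie bracket on V^*, moved from V^** to V. *)
Definition coad_dual (F : fieldType) (V : vectType F)
    (brd : dual V -> dual V -> dual V) (a : dual V) (x : V) : V :=
  ((bidual V)^-1)%VF (coad brd a (bidual V x)).

Lemma coad_dualE (F : fieldType) (V : vectType F)
    (brd : dual V -> dual V -> dual V) (a b : dual V) (x : V) :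
  bilinear brd -> b (coad_dual brd a x) = - (brd a b x).
Proof.
move=> [_ lin]; rewrite -[LHS]bidualE bidualK opp_lfunE comp_lfunE bidualE.
by rewrite /ad (linfun_linE _ (lin a)).
Qed.

Definition dsum_map_fun (F : fieldType) (V W : vectType F)
    (N : 'End(V)) (S : 'End(W)) (u : V * W) : V * W := (N u.1, S u.2).

Lemma dsum_map_linear (F : fieldType) (V W : vectType F)
    (N : 'End(V)) (S : 'End(W)) : linear (dsum_map_fun N S).
Proof. by move=> c u v; rewrite /dsum_map_fun /= !linearP. Qed.

HB.instance Definition _ (F : fieldType) (V W : vectType F)
    (N : 'End(V)) (S : 'End(W)) :=
  GRing.isLinear.Build F (V * W)%type (V * W)%type *:%R (dsum_map_fun N S)
    (dsum_map_linear N S).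

Definition dsum_map (F : fieldType) (V W : vectType F)
    (N : 'End(V)) (S : 'End(W)) : 'End((V * W)%type) :=
  linfun (dsum_map_fun N S).

Lemma dsum_mapE (F : fieldType) (V W : vectType F)
    (N : 'End(V)) (S : 'End(W)) (u : V * W) :
  dsum_map N S u = (N u.1, S u.2).
Proof. exact: lfunE. Qed.

Definition dual_form (F : fieldType) (V : vectType F) (u v : V * dual V) : F :=
  u.2 v.1 + v.2 u.1.

Definition nijenhuis_manin_triple (F : fieldType) (V : vectType F)
    (brD : V * dual V -> V * dual V -> V * dual V)
    (ND : 'End((V * dual V)%type))
    (br : V -> V -> V) (N : 'End(V))
    (brd : dual V -> dual V -> dual V) (S : 'End(dual V)) : Prop :=
  [/\ nijenhuis_lie_algebra brD ND,
      [/\ nijenhuis_lie_algebra br N,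
          forall x y, brD (x, 0) (y, 0) = (br x y, 0)
        & forall x, ND (x, 0) = (N x, 0)],
      [/\ nijenhuis_lie_algebra brd S,
          forall a b, brD (0, a) (0, b) = (0, brd a b)
        & forall a, ND (0, a) = (0, S a)]
    & forall u v w,
        dual_form (brD u v) w + dual_form v (brD u w) = 0].

(* Main.v *)
Require Import Defs.
From HB Require Import structures.
From mathcomp Require Import all_boot all_algebra ring.

Set Implicit Arguments.
Unset Strict Implicit.
Unset Printing Implicit Defensive.

Import GRing.Theory.
Local Open Scope ring_scope.

(** Every condition in the theorem is an equality of vectors, of linear forms
or of tensors, and such equalities can be tested by pairing: with linear forms
([dual_separates]) or with elementary tensors of linear forms
([tpair_separates]).  Once tested, a condition is an identity between scalars
of the form <b, [x, y]> and <[a, b], x>, the cobracket entering only through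
the dual bracket <[a, b], x> = <delta x, a (x) b>.  The coadjoint actions are
adjoints of the two brackets, so the conditions of (i) and those of (ii) become
the same scalar identities up to skew-symmetry.

Between (i) and (ii), the correspondence is the following.
- The cocycle condition paired with a (x) b ([cocycle_pairing]) is the first
  compatibility of a matched pair evaluated at y
  ([cocycle_coad_derivation]), and also the second compatibility, for a, paired
  with b ([cocycle_coad_dual_derivation]).  So a single condition of (i) gives
  both, and each of them gives it back.
- The compatibility of N and S expressed with the bracket says that ad* with the
  transpose of S is a Nijenhuis representation ([coad_nijenhuis_iff]), and the
  one expressed with delta says the same of the coadjoint action of g^* with N
  ([coad_dual_nijenhuis_iff]).
- The remaining parts of a matched pair hold in all cases: coadjoint actions are
  representations, and the dual of a Nijenhuis Lie coalgebra is a Nijenhuis Lie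
  algebra ([dual_bracket_nijenhuis]).

Between (ii) and (iii), the statement is not special to duals: for any two
Nijenhuis Lie algebras acting on each other by bilinear maps, the bicrossed
bracket with the direct sum operator is a Nijenhuis Lie algebra exactly when the
data form a matched pair ([bicrossed_nijenhuis_lie_algebra]).  The bicrossed
bracket is invariant under exchange of its two factors, so only its
first component has to be computed.  In the coadjoint case the two factors are
subalgebras and the pairing is invariant
([dual_form_bicrossed_invariant]) by the very definition of the coadjoint
actions, so a Manin triple amounts to the Nijenhuis Lie algebra alone.

Scalar identities are closed by the ring decision procedure, which is why many
proofs in a vector space begin by applying an arbitrary linear form. *)

(** * Pairings of tensors with linear forms *)

Section Pairing.
Variables (F : fieldType) (V : vectType F).
Implicit Types (a b c : dual V) (x y z : V).

(** This is the injectivity of the map to the bidual. *)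
Lemma dual_separates x y : (forall a, a x = a y) -> x = y.
Proof.
move=> eq_xy; have /lker0P inj := bidual_inj V.
by apply: inj; apply/lfunP => a; rewrite !bidualE.
Qed.

(** The coordinate forms of a basis of V recover every matrix entry of a tensor. *)
Lemma tpair_separates (s t : tensor V V) :
  (forall a b, tpair a b s = tpair a b t) -> s = t.
Proof.
have lin i : linear (coord (vbasis {:V}) i : V -> F^o) by exact: linearP.
pose e i : dual V := linfun (coord (vbasis {:V}) i : V -> F^o).
have tE i j (u : tensor V V) : tpair (e i) (e j) u = u i j.
  rewrite {1}[u]matrix_sum_delta linear_sum (bigD1 i) //= linear_sum (bigD1 j) //=.
  have val k l : tpair (e i) (e j) (delta_mx k l) = ((i == k) && (j == l))%:R.
    rewrite -tens_vbasis tpairE !(linfun_linE _ (lin _)).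
    rewrite !coord_free ?(basis_free (vbasisP _)) //.
    by rewrite -natrM mulnb [i == k]eq_sym [j == l]eq_sym.
  rewrite !linearZ /= val !eqxx big1 => [|l ne_lj]; last first.
    by rewrite linearZ /= val eqxx eq_sym (negPf ne_lj) scaler0.
  rewrite big1 => [|k ne_ki].
    by rewrite !addr0; exact: mulr1.
  rewrite linear_sum big1 // => l _.
  by rewrite linearZ /= val eq_sym (negPf ne_ki) scaler0.
by move=> eq_st; apply/matrixP => i j; rewrite -!tE.
Qed.

Lemma tpair_linearl b : linear (fun a => tpair a b).
Proof.
move=> k a a'; apply: tlift_uniq => x y.
by rewrite !(add_lfunE, scale_lfunE, tpairE) mulrDl -scalerAl.
Qed.

Lemma tpair_linearr a : linear (tpair a).
Proof.
move=> k b b'; apply: tlift_uniq => x y.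
by rewrite !(add_lfunE, scale_lfunE, tpairE) mulrDr -scalerAr.
Qed.

Lemma tpair_bilinear : Defs.bilinear (@tpair F V).
Proof. by split; [exact: tpair_linearl | exact: tpair_linearr]. Qed.

Lemma tpair_tmap a b (f h : 'End(V)) t :
  tpair a b (tmap f h t) = tpair (a \o f)%VF (b \o h)%VF t.
Proof.
rewrite -comp_lfunE; congr (fun_of_lfun _ t); apply: tlift_uniq => x y.
by rewrite comp_lfunE tmapE !tpairE !comp_lfunE.
Qed.

Lemma tpair_tflip a b t : tpair a b (tflip V t) = tpair b a t.
Proof.
rewrite -comp_lfunE; congr (fun_of_lfun _ t); apply: tlift_uniq => x y.
by rewrite comp_lfunE tflipE !tpairE mulrC.
Qed.

(** The pairing <t, a (x) b (x) c>, for t in V (x) (V (x) V); it turns the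
co-Jacobi identity into the Jacobi identity of the dual bracket. *)
Definition tpair3 a b c : dual (tensor V (tensor V V)) :=
  tlift (fun x t => (a x * tpair b c t : F^o)).

Lemma tpair3E a b c x t : tpair3 a b c (tens x t) = a x * tpair b c t.
Proof.
rewrite /tpair3 tliftE //; split=> [s | y] k u u'; rewrite linearP /=.
  by rewrite mulrDl -scalerAl.
by rewrite mulrDr -scalerAr.
Qed.

Lemma tpair3_trot a b c t : tpair3 a b c (trot V t) = tpair3 c a b t.
Proof.
have [tl tr] := @tens_bilinear F V (tensor V V).
rewrite -comp_lfunE; congr (fun_of_lfun _ t); apply: tlift_uniq => x s.
rewrite comp_lfunE tpair3E.
(* Both sides are linear in s, so s may be taken of the form y (x) z. *)
have lin1 : linear (fun s : tensor V V => tpair3 a b c (trot V (tens x s)) : F^o).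
  by move=> k u u'; rewrite (tr x k) !linearP.
have lin2 : linear (fun s : tensor V V => c x * tpair a b s : F^o).
  by move=> k u u'; rewrite linearP mulrDr -scalerAr.
rewrite -(linfun_linE s lin1) -(linfun_linE s lin2); congr (fun_of_lfun _ s).
apply: tlift_uniq => y z; rewrite (linfun_linE _ lin1) (linfun_linE _ lin2).
by rewrite trotE !tpair3E !tpairE mulrA mulrC.
Qed.

Lemma tpair3_tmap_id a b c (f : 'Hom(V, tensor V V)) t :
  tpair3 a b c (tmap \1 f t) = tpair a (tpair b c \o f)%VF t.
Proof.
rewrite -comp_lfunE; congr (fun_of_lfun _ t); apply: tlift_uniq => x y.
by rewrite comp_lfunE tmapE tpair3E tpairE id_lfunE comp_lfunE.
Qed.

End Pairing.

(** * Arithmetic of bilinear maps *)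

Section Bilinear.
Variables (F : fieldType) (U V W : vectType F) (f : U -> V -> W).
Hypothesis f_bilin : Defs.bilinear f.

Lemma bilinDl v : {morph f^~ v : u u' / u + u'}.
Proof. by move=> u u'; have := f_bilin.1 v 1 u u'; rewrite !scale1r. Qed.

Lemma bilinDr u : {morph f u : v v' / v + v'}.
Proof. by move=> v v'; have := f_bilin.2 u 1 v v'; rewrite !scale1r. Qed.

Lemma bilin0l v : f 0 v = 0.
Proof. by apply: (addrI (f 0 v)); rewrite -bilinDl !addr0. Qed.

Lemma bilin0r u : f u 0 = 0.
Proof. by apply: (addrI (f u 0)); rewrite -bilinDr !addr0. Qed.

Lemma bilinNl v : {morph f^~ v : u / - u}.
Proof. by move=> u; apply: (addrI (f u v)); rewrite -bilinDl !subrr bilin0l. Qed.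

Lemma bilinNr u : {morph f u : v / - v}.
Proof. by move=> v; apply: (addrI (f u v)); rewrite -bilinDr !subrr bilin0r. Qed.

Definition bilinE := (bilinDl, bilinDr, bilinNl, bilinNr, bilin0l, bilin0r).

End Bilinear.

(** * First component of the bicrossed bracket *)

Section BicrossedComponent.
Variables (F : fieldType) (V W : vectType F).
Variables (brV : V -> V -> V) (brW : W -> W -> W).
Variables (rho : V -> W -> W) (nu : W -> V -> V).
Hypothesis lieV : lie_algebra brV.
Hypotheses (brW_bilin : Defs.bilinear brW).
Hypotheses (rho_bilin : Defs.bilinear rho) (nu_bilin : Defs.bilinear nu).

Local Notation B := (bicrossed brV brW rho nu).

(** On (x, 0), (0, h), (0, k) the first component of the Jacobi sum says that nu
is a representation of W, and on (x, 0), (y, 0), (0, h) it is the compatibility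
of nu with the bracket of V.  Conversely, once both are used as rewriting rules,
every mixed term of the sum cancels and the Jacobi sum of V is left. *)
Lemma bicrossed_jacobi_fst :
  (forall u v w, (B u (B v w) + B v (B w u) + B w (B u v)).1 = 0) <->
  (forall h k x, nu (brW h k) x = nu h (nu k x) - nu k (nu h x)) /\
  (forall h x y, nu h (brV x y) =
     brV (nu h x) y + brV x (nu h y) + nu (rho y h) x - nu (rho x h) y).
Proof.
have [brV_bilin skewV jacV] := lieV.
split=> [jac | [nu_rep nu_der] [x a] [y b] [z c]].
  split=> [h k x | h x y].
    have /= := jac (x, 0) (0, h) (0, k).
    rewrite !(bilinE brV_bilin, bilinE nu_bilin, bilinE rho_bilin).
    rewrite !(bilinE brW_bilin, oppr0, subr0, sub0r, add0r, addr0).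
    by rewrite -addrA addrC => /subr0_eq ->.
  have /= := jac (x, 0) (y, 0) (0, h).
  rewrite !(bilinE brV_bilin, bilinE nu_bilin, bilinE rho_bilin).
  rewrite !(bilinE brW_bilin, oppr0, subr0, sub0r, add0r, addr0).
  rewrite (bilin0l nu_bilin) (bilin0l nu_bilin) !add0r => jac0.
  apply: dual_separates => f; apply: subr0_eq.
  rewrite (skewV (nu h x)) !(linearD, linearN) /=.
  by move/(congr1 f): jac0; rewrite !(linearD, linearN) linear0 /= => <-; ring.
rewrite /bicrossed /=.
rewrite !(bilinE brV_bilin, bilinE nu_bilin, nu_rep, nu_der).
rewrite (skewV (nu a y)) (skewV (nu b z)) (skewV (nu c x)).
apply: dual_separates => f; rewrite !(linearD, linearN, linear0) /=.
have := congr1 f (jacV x y z); rewrite !linearD linear0 /= => jac.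
rewrite -[RHS]jac; ring.
Qed.

(** Here only the pair (0, h), (x, 0) carries information: the first component of
the Nijenhuis identity is the one of V plus two mixed terms, each an instance of
the identity for nu. *)
Lemma bicrossed_nijenhuis_fst (N : 'End(V)) (S : 'End(W)) :
  (forall x y, brV (N x) (N y) = N (brV (N x) y + brV x (N y) - N (brV x y))) ->
  (forall u v,
     (B (dsum_map N S u) (dsum_map N S v)).1 =
     (dsum_map N S (B (dsum_map N S u) v + B u (dsum_map N S v)
        - dsum_map N S (B u v))).1) <->
  (forall h x,
     nu (S h) (N x) = N (nu (S h) x + nu h (N x) - N (nu h x))).
Proof.
have [brV_bilin _ _] := lieV.
move=> nijV; split=> [nij h x | nij [x a] [y b]].
  have := nij (0, h) (x, 0); rewrite !dsum_mapE /= !linear0.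
  rewrite !(bilinE brV_bilin, bilinE nu_bilin, bilinE rho_bilin).
  by rewrite !(oppr0, subr0, sub0r, add0r, addr0).
rewrite !dsum_mapE /bicrossed /= nijV !nij.
apply: dual_separates => f; rewrite !(linearD, linearN) /=.
by ring.
Qed.

End BicrossedComponent.

(** * Bicrossed products and matched pairs *)

Section Bicrossed.
Variables (F : fieldType) (V W : vectType F).
Variables (brV : V -> V -> V) (brW : W -> W -> W).
Variables (rho : V -> W -> W) (nu : W -> V -> V).
Hypotheses (rho_bilin : Defs.bilinear rho) (nu_bilin : Defs.bilinear nu).

Local Notation B := (bicrossed brV brW rho nu).

Lemma bicrossed_bilinear :
  Defs.bilinear brV -> Defs.bilinear brW -> Defs.bilinear B.
Proof.
move=> [brVl brVr] [brWl brWr]; have [[rhol rhor] [nul nur]] := (rho_bilin, nu_bilin).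
have scE (c : F) (r : F^o) : c *: r = c * r :> F by [].
split=> [[y b] | [y b]] k [x a] [x' a']; rewrite /bicrossed /=; congr (_, _) => /=.
- rewrite (brVl y k) (nul y k) (nur b k); apply: dual_separates => f.
  by rewrite !(linearD, linearN, linearZ) /= !scE; ring.
- rewrite (brWl b k) (rhol b k) (rhor y k); apply: dual_separates => f.
  by rewrite !(linearD, linearN, linearZ) /= !scE; ring.
- rewrite (brVr y k) (nul y k) (nur b k); apply: dual_separates => f.
  by rewrite !(linearD, linearN, linearZ) /= !scE; ring.
rewrite (brWr b k) (rhol b k) (rhor y k); apply: dual_separates => f.
by rewrite !(linearD, linearN, linearZ) /= !scE; ring.
Qed.

(** The second component of the bicrossed bracket is, definitionally, the first
component of the bicrossed bracket with the factors exchanged, which is why the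
first-component lemmas are used once for V and once for W. *)
Lemma bicrossed_lie_algebra :
  lie_algebra brV -> lie_algebra brW ->
  lie_algebra B <-> matched_pair brV brW rho nu.
Proof.
move=> lieV lieW; have [brV_bilin skewV _] := lieV.
have [brW_bilin skewW _] := lieW.
have fstP := bicrossed_jacobi_fst lieV brW_bilin rho_bilin nu_bilin.
have sndP := bicrossed_jacobi_fst lieW brV_bilin nu_bilin rho_bilin.
split=> [[_ _ jac] | [_ [_ rho_rep] [_ nu_rep] rho_der nu_der]].
  have [|nu_rep nu_der] := fstP.1; first by move=> u v w; rewrite jac.
  have [|rho_rep rho_der] := sndP.1.
    move=> [a x] [b y] [c z].
    exact: (congr1 snd (jac (x, a) (y, b) (z, c))).
  by [].
split; first exact: bicrossed_bilinear.
  move=> [x a] [y b]; rewrite /bicrossed /=; congr (_, _) => /=.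
    by rewrite skewV !opprD opprK addrAC.
  by rewrite skewW !opprD opprK addrAC.
move=> [x a] [y b] [z c]; apply: injective_projections.
  exact: (fstP.2 (conj nu_rep nu_der)).
exact: (sndP.2 (conj rho_rep rho_der) (a, x) (b, y) (c, z)).
Qed.

Lemma bicrossed_nijenhuis_lie_algebra (N : 'End(V)) (S : 'End(W)) :
  nijenhuis_lie_algebra brV N -> nijenhuis_lie_algebra brW S ->
  nijenhuis_lie_algebra B (dsum_map N S) <->
  nijenhuis_matched_pair brV N brW S rho nu.
Proof.
move=> nlV nlW; have [[lieV nijV] [lieW nijW]] := (nlV, nlW).
have [brV_bilin _ _] := lieV; have [brW_bilin _ _] := lieW.
have fstP := bicrossed_nijenhuis_fst brW rho lieV nu_bilin S nijV.
have sndP := bicrossed_nijenhuis_fst brV nu lieW rho_bilin N nijW.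
have lieP := bicrossed_lie_algebra lieV lieW.
split=> [[lieB nijB] | [_ _ mp [_ rho_nij] [_ nu_nij]]].
  have mp := lieP.1 lieB; have [_ rho_rep nu_rep _ _] := mp.
  split=> //; split=> //.
    apply: sndP.1 => -[a x] [b y].
    have := congr1 snd (nijB (x, a) (y, b)).
    by rewrite !dsum_mapE.
  by apply: fstP.1 => u v; rewrite nijB.
split; first exact: lieP.2.
move=> [x a] [y b]; apply: injective_projections; first exact: fstP.2.
have := sndP.2 rho_nij (a, x) (b, y).
by rewrite !dsum_mapE.
Qed.

End Bicrossed.

(** * The dual of a Nijenhuis Lie coalgebra *)

Section Dual.
Variables (F : fieldType) (g : vectType F).
Variable delta : 'Hom(g, tensor g g).
Local Notation D := (dual_bracket delta).

Lemma dual_bracketE a b x : D a b x = tpair a b (delta x).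
Proof. by rewrite comp_lfunE. Qed.

Lemma dual_bracket_bilinear : Defs.bilinear D.
Proof.
split=> [b k a a' | a k b b']; apply/lfunP => x.
  rewrite add_lfunE scale_lfunE !dual_bracketE (tpair_linearl b k).
  by rewrite add_lfunE scale_lfunE.
rewrite add_lfunE scale_lfunE !dual_bracketE (tpair_linearr a k).
by rewrite add_lfunE scale_lfunE.
Qed.

Lemma dual_bracket_skew :
  delta = - (tflip g \o delta)%VF -> forall a b, D a b = - D b a.
Proof.
move=> skew a b; apply/lfunP => x.
rewrite opp_lfunE !dual_bracketE {1}skew opp_lfunE linearN comp_lfunE /=.
by rewrite tpair_tflip.
Qed.

(** Pairing (1 (x) delta) (delta x) with a (x) b (x) c gives <[a, [b, c]], x>, and
the rotation of tensors permutes a, b, c cyclically. *)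
Lemma dual_bracket_lie : lie_coalgebra delta -> lie_algebra D.
Proof.
move=> [skew jac]; split.
- exact: dual_bracket_bilinear.
- exact: dual_bracket_skew.
move=> a b c; apply/lfunP => x.
have := congr1 (fun f => tpair3 a b c (fun_of_lfun f x)) jac.
rewrite !(comp_lfunE, add_lfunE, id_lfunE, zero_lfunE) linear0 !linearD.
rewrite /= !tpair3_trot !tpair3_tmap_id /= => jac_x.
by rewrite -[RHS]jac_x -!addrA; congr (_ + _); rewrite addrC.
Qed.

Lemma dual_bracket_nijenhuis (S : 'End(g)) :
  nijenhuis_lie_coalgebra delta S -> nijenhuis_lie_algebra D (transpose S).
Proof.
move=> [lieC nij]; split; first exact: dual_bracket_lie.
move=> a b; apply/lfunP => x.
have := congr1 (tpair a b) (nij x).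
rewrite add_lfunE linearB linearD /= !tpair_tmap !comp_lfun1r => nij_x.
by rewrite !(transposeE, comp_lfunE, opp_lfunE, add_lfunE).
Qed.

End Dual.

Lemma sub_lfunE (F : fieldType) (V W : vectType F) (f h : 'Hom(V, W)) x :
  (f - h) x = f x - h x.
Proof. by rewrite add_lfunE opp_lfunE. Qed.

(** * Coadjoint actions *)

Section Coadjoint.
Variables (F : fieldType) (g : vectType F) (br : g -> g -> g).

Lemma coadE x a y : Defs.bilinear br -> coad br x a y = - a (br x y).
Proof.
move=> [_ lin]; rewrite opp_lfunE comp_lfunE.
by rewrite /ad (linfun_linE _ (lin x)).
Qed.

Lemma coad_bilinear : Defs.bilinear br -> Defs.bilinear (coad br).
Proof.
move=> bil; split=> [a k x x' | x k a a']; apply/lfunP => y.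
  rewrite add_lfunE scale_lfunE !coadE // (bil.1 y k) linearP.
  by rewrite opprD scalerN.
by rewrite !(add_lfunE, scale_lfunE, coadE) // opprD scalerN.
Qed.

Lemma coad_representation :
  lie_algebra br -> lie_representation br (coad br).
Proof.
move=> [bil skew jac]; split=> [|x y a]; first exact: coad_bilinear.
apply/lfunP => z; rewrite sub_lfunE !coadE //.
have := congr1 a (jac x y z); rewrite !linearD linear0 /= => jac_z.
(* The instance a keeps linearN from rewriting with opposite as the linear map. *)
apply: subr0_eq; rewrite -jac_z (skew z (br x y)) (skew z x) (bilinNr bil).
rewrite !(linearN a) /=; ring.
Qed.

Variable brd : dual g -> dual g -> dual g.

Lemma coad_dual_bilinear : Defs.bilinear brd -> Defs.bilinear (coad_dual brd).
Proof.
move=> bil; split=> [x k a a' | a k x x']; apply: dual_separates => b.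
  rewrite linearP /= !coad_dualE // (bil.1 b k) add_lfunE scale_lfunE.
  by rewrite opprD scalerN.
by rewrite linearP /= !coad_dualE // linearP opprD scalerN.
Qed.

Lemma coad_dual_representation :
  lie_algebra brd -> lie_representation brd (coad_dual brd).
Proof.
move=> [bil skew jac]; split=> [|a b x]; first exact: coad_dual_bilinear.
apply: dual_separates => c; rewrite linearB /= !coad_dualE //.
have := congr1 (fun f : dual g => f x) (jac a b c).
rewrite !add_lfunE zero_lfunE => jac_x.
apply: subr0_eq; rewrite -jac_x (skew c (brd a b)) (skew c a) (bilinNr bil).
rewrite !opp_lfunE; ring.
Qed.

End Coadjoint.

(** * Bialgebra conditions in terms of coadjoint actions *)

Section Bialgebra.
Variables (F : fieldType) (g : vectType F) (br : g -> g -> g).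
Variables (N S : 'End(g)) (delta : 'Hom(g, tensor g g)).
Hypothesis lie_br : lie_algebra br.
Hypothesis lie_delta : lie_coalgebra delta.

Local Notation D := (dual_bracket delta).
Local Notation rho := (coad br).
Local Notation nu := (coad_dual D).

Let br_bilin : Defs.bilinear br. Proof. by case: lie_br. Qed.
Let br_skew x y : br x y = - br y x. Proof. by case: lie_br. Qed.
Let D_bilin : Defs.bilinear D := dual_bracket_bilinear delta.
Let D_skew a b : D a b = - D b a.
Proof. by case: lie_delta => /dual_bracket_skew ->. Qed.

(** At a and y, the Nijenhuis identity for ad* is minus the value of a
on S [Nx, y] = [Nx, Sy] + S [x, Sy] - [x, S^2 y]. *)
Lemma coad_nijenhuis_iff :
  (forall x y, S (br (N x) y) + br x (S (S y)) = br (N x) (S y) + S (br x (S y)))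
  <->
  (forall x a, rho (N x) (transpose S a) =
     transpose S (rho (N x) a + rho x (transpose S a)
       - transpose S (rho x a))).
Proof.
have tE a y : transpose S a y = a (S y) by rewrite transposeE comp_lfunE.
have lhsE x y a : rho (N x) (transpose S a) y = - a (S (br (N x) y)).
  by rewrite coadE // tE.
have rhsE x y a : transpose S (rho (N x) a + rho x (transpose S a)
    - transpose S (rho x a)) y
  = - a (br (N x) (S y) + S (br x (S y)) - br x (S (S y))).
  rewrite tE sub_lfunE add_lfunE tE !coadE // tE !(linearD a, linearN a) /=.
  ring.
split=> [compat x a | nij x y].
  by apply/lfunP => y; rewrite lhsE rhsE -compat addrK.
apply: dual_separates => a.
have := congr1 (fun f : dual g => f y) (nij x a); rewrite lhsE rhsE.
by move/oppr_inj => nij_y; rewrite [LHS]linearD /= nij_y -linearD subrK.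
Qed.

(** Skew-symmetry rewrites b (nu a x) as <[b, a], x>.  This order of the two
forms places N on the first tensor factor and S on the second, as in the left
side, so that no flip of tensors remains. *)
Lemma coad_dual_nijenhuis_iff :
  (forall x, tmap N S (delta x) + (tmap N \1 - tmap \1 S)%VF (delta (N x))
     - tmap (N \o N)%VF \1%VF (delta x) = 0) <->
  (forall a x, nu (transpose S a) (N x) =
     N (nu (transpose S a) x + nu a (N x) - N (nu a x))).
Proof.
have lhsE (a b : dual g) x : b (nu (transpose S a) (N x))
  = tpair b a (tmap \1 S (delta (N x))).
  rewrite coad_dualE // D_skew opp_lfunE opprK dual_bracketE.
  by rewrite tpair_tmap comp_lfun1r transposeE.
have rhsE (a b : dual g) x :
    b (N (nu (transpose S a) x + nu a (N x) - N (nu a x)))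
  = tpair b a (tmap N S (delta x) + tmap N \1 (delta (N x))
      - tmap (N \o N)%VF \1%VF (delta x)).
  rewrite !(linearD, linearN) /= !tpair_tmap !comp_lfun1r -!dual_bracketE.
  have push (c d : dual g) y : c (N (nu d y)) = D (c \o N)%VF d y.
    by rewrite -comp_lfunE coad_dualE // D_skew opp_lfunE opprK.
  by rewrite !push -[b (N (N _))]comp_lfunE push -comp_lfunA transposeE.
have swap x : tmap N S (delta x) + (tmap N \1 - tmap \1 S)%VF (delta (N x))
    - tmap (N \o N)%VF \1%VF (delta x)
  = tmap N S (delta x) + tmap N \1 (delta (N x))
      - tmap (N \o N)%VF \1%VF (delta x) - tmap \1 S (delta (N x)).
  by rewrite sub_lfunE addrA [LHS]addrAC.
split=> [compat a x | nij x].
  apply: dual_separates => b; rewrite lhsE rhsE; congr (tpair b a _).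
  by apply/esym/subr0_eq; rewrite -swap.
rewrite swap; apply/eqP; rewrite subr_eq0; apply/eqP; apply: tpair_separates => b a.
by rewrite -rhsE -lhsE nij.
Qed.

(** The condition that delta be a 1-cocycle of g with values in g (x) g. *)
Definition cocycle_condition := forall x y,
  delta (br x y) =
    (tmap (ad br x) \1 + tmap \1 (ad br x))%VF (delta y)
    - (tmap (ad br y) \1 + tmap \1 (ad br y))%VF (delta x).

Lemma cocycle_pairing :
  cocycle_condition <->
  (forall x y a b, D a b (br x y) =
     - D (rho x a) b y - D a (rho x b) y + D (rho y a) b x + D a (rho y b) x).
Proof.
have adE x a : (a \o ad br x)%VF = - rho x a by rewrite opprK.
have sideE x a b t : tpair a b ((tmap (ad br x) \1 + tmap \1 (ad br x))%VF t)
  = - tpair (rho x a) b t - tpair a (rho x b) t.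
  rewrite add_lfunE linearD /= !tpair_tmap !comp_lfun1r !adE.
  have tb := @tpair_bilinear F g.
  by rewrite (bilinNl tb) (bilinNr tb) !opp_lfunE.
split=> [coc x y a b | coc x y].
  by rewrite !dual_bracketE coc linearB /= !sideE; ring.
apply: tpair_separates => a b.
by rewrite linearB /= !sideE -dual_bracketE coc !dual_bracketE; ring.
Qed.

(** Both sides are - (ad*_y b) (nu a x): the two coadjoint actions are defined by
the same pairing, and this exchanges a bracket of g for one of g^*. *)
Lemma coad_adjoint (a b : dual g) x y : b (br y (nu a x)) = D a (rho y b) x.
Proof.
by rewrite -[LHS]opprK -(coadE _ _ _ br_bilin) coad_dualE // opprK.
Qed.

(** At y, each side is a combination of values <[a, b], x> with coadjoint actions
applied to the forms: [coad_adjoint] brings the two terms with nu into that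
shape, and [cocycle_pairing] is the resulting identity. *)
Lemma cocycle_coad_derivation :
  cocycle_condition <->
  (forall x a b, rho x (D a b) =
     D (rho x a) b + D a (rho x b) + rho (nu b x) a - rho (nu a x) b).
Proof.
apply: (iff_trans cocycle_pairing).
have pairE x y (a b : dual g) : (D (rho x a) b + D a (rho x b) + rho (nu b x) a
     - rho (nu a x) b) y
  = D (rho x a) b y + D a (rho x b) y - D (rho y a) b x - D a (rho y b) x.
  rewrite sub_lfunE !add_lfunE !coadE //.
  rewrite (br_skew (nu b x)) (br_skew (nu a x)) !(linearN a) !(linearN b) /=.
  rewrite !coad_adjoint (D_skew b) opp_lfunE; ring.
split=> [coc x a b | der x y a b].
  apply/lfunP => y; rewrite pairE coadE // coc; ring.
by rewrite -[LHS]opprK -(coadE _ _ _ br_bilin) der pairE; ring.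
Qed.

(** Paired with b, the four terms on the right are the four terms on the right of
[cocycle_pairing]; the roles of the bracket terms and of the terms with rho are
exchanged with respect to [cocycle_coad_derivation]. *)
Lemma cocycle_coad_dual_derivation :
  cocycle_condition <->
  (forall a x y, nu a (br x y) =
     br (nu a x) y + br x (nu a y) + nu (rho y a) x - nu (rho x a) y).
Proof.
apply: (iff_trans cocycle_pairing).
have pairE x y (a b : dual g) : b (br (nu a x) y + br x (nu a y) + nu (rho y a) x
     - nu (rho x a) y)
  = - D a (rho y b) x + D a (rho x b) y - D (rho y a) b x + D (rho x a) b y.
  rewrite !(linearD b, linearN b) /= !coad_dualE // (br_skew (nu a x)).
  rewrite (linearN b) /= !coad_adjoint; ring.
split=> [coc a x y | der x y a b].
  by apply: dual_separates => b; rewrite pairE coad_dualE // coc; ring.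
by apply: oppr_inj; rewrite -[LHS](coad_dualE _ _ _ D_bilin) der pairE; ring.
Qed.

(** Each coadjoint term is, by definition of the action, minus a bracket term, so
that all terms cancel in pairs up to skew-symmetry of the two brackets. *)
Lemma dual_form_bicrossed_invariant u v w :
  dual_form (bicrossed br D rho nu u v) w
    + dual_form v (bicrossed br D rho nu u w) = 0.
Proof.
case: u v w => [x a] [y b] [z c]; rewrite /dual_form /=.
have sndE x' y' z' a' b' : (D a' b' + rho x' b' - rho y' a') z'
  = D a' b' z' - b' (br x' z') + a' (br y' z').
  by rewrite sub_lfunE add_lfunE !coadE // opprK.
rewrite !sndE.
rewrite !(linearD b, linearD c, linearN b, linearN c) /= !coad_dualE //.
rewrite (br_skew z y) (D_skew c b) (linearN a) opp_lfunE /=; ring.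
Qed.

End Bialgebra.

(** * Bialgebras, matched pairs and Manin triples *)

Theorem theorem6p11 (F : fieldType) (g : vectType F)
    (br : g -> g -> g) (N : 'End(g))
    (delta : 'Hom(g, tensor g g)) (S : 'End(g))
    (hN : nijenhuis_lie_algebra br N)
    (hS : nijenhuis_lie_coalgebra delta S) :
  (nijenhuis_lie_bialgebra br N delta S <->
   nijenhuis_matched_pair br N (dual_bracket delta) (transpose S)
     (coad br) (coad_dual (dual_bracket delta)))
  /\
  (nijenhuis_matched_pair br N (dual_bracket delta) (transpose S)
     (coad br) (coad_dual (dual_bracket delta)) <->
   nijenhuis_manin_triple
     (bicrossed br (dual_bracket delta)
        (coad br) (coad_dual (dual_bracket delta)))
     (dsum_map N (transpose S))
     br N (dual_bracket delta) (transpose S)).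
Proof.
have [[lie_br _] [lie_delta _]] := (hN, hS).
have hD := dual_bracket_nijenhuis hS; have [lie_D _] := hD.
have [br_bilin _ _] := lie_br; have [D_bilin _ _] := lie_D.
have rho_rep := coad_representation lie_br.
have nu_rep := coad_dual_representation lie_D.
have [[rho_bilin _] [nu_bilin _]] := (rho_rep, nu_rep).
have rhoP := cocycle_coad_derivation lie_br lie_delta.
have nuP := cocycle_coad_dual_derivation delta lie_br.
have rho_nijP := coad_nijenhuis_iff N S lie_br.
have nu_nijP := coad_dual_nijenhuis_iff N S lie_delta.
split.
  split=> [[_ _ [_ _ coc] compat_b compat_c] | [_ _ mp [_ rho_nij] [_ nu_nij]]].
    split=> //.
    - by split=> //; [exact/rhoP | exact/nuP].
    - by split=> //; exact/rho_nijP.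
    by split=> //; exact/nu_nijP.
  have [_ _ _ /rhoP coc _] := mp.
  by split=> //; [exact/rho_nijP | exact/nu_nijP].
have bicrossedP := bicrossed_nijenhuis_lie_algebra rho_bilin nu_bilin hN hD.
split=> [/bicrossedP nij | [/bicrossedP ]//].
split=> //.
- split=> // [x y | x]; rewrite ?dsum_mapE /bicrossed /= ?linear0 //.
  rewrite !(bilin0l nu_bilin) (bilin0r rho_bilin) (bilin0l D_bilin).
  by rewrite (bilin0r rho_bilin) !(addr0, subr0).
- split=> // [a b | a]; rewrite ?dsum_mapE /bicrossed /= ?linear0 //.
  rewrite !(bilin0l rho_bilin) (bilin0r nu_bilin) (bilin0l br_bilin).
  by rewrite (bilin0r nu_bilin) !(addr0, subr0).
exact: dual_form_bicrossed_invariant.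
Qed.
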